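(* Let $\boldsymbol{\Delta}_1=\{\delta_t^{\bar x},\ \bar x\in X^{t^c},\ t\in\mathbb{Z}^d\}$ be a quasilocal one-point transition energy field on $\mathbb{Z}^d$ with finite state space $X$. Then there exists a (positive) random field $P$ corresponding to $\boldsymbol{\Delta}_1$, that is, such that for every filtration $\mathcal{F}$ the one-point transition energies of $P$ with respect to $\mathcal{F}$ satisfy $$\Delta_t^{\bar x}(x,u)=\delta_t^{\bar x}(x,u),\qquad x,u\in X^t,\ \bar x\in\mathcal{X}_t(\mathcal{F}),\ t\in\mathbb{Z}^d,$$ and $P$ is a Gibbs random field.
   Context: Notation. $X$ is a finite set, $1<|X|<\infty$; $d\ge 1$; $W$ is the set of nonempty finite subsets of $\mathbb{Z}^d$. For $S\subset\mathbb{Z}^d$, $W(S)$ is the set of nonempty finite subsets of $S$, $S^c$ is its complement, $X^S$ is the set of all functions (configurations) $S\to X$, and $x_T$ is the restriction of $x\in X^S$ to $T\subset S$; $X^{\emptyset}$ consists of the empty configuration. For disjoint $S,T$ and $x\in X^S$, $y\in X^T$, $xy\in X^{S\cup T}$ is the concatenation. Braces of singletons are omitted: $t$ stands for $\{t\}$. $X^S$ carries the product $\sigma$-algebra $\mathcal{B}^S$ (of the discrete ones). For $h:W(S)\to\mathbb{R}$, $\lim_{\Lambda\uparrow S}h(\Lambda)=a$ means: for every $\varepsilon>0$ there is $\Lambda_\varepsilon\in W(S)$ with $|h(\Lambda)-a|<\varepsilon$ for all $\Lambda\in W(S)$, $\Lambda\supset\Lambda_\varepsilon$. One-point transition energy field: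 a set $\boldsymbol{\Delta}_1=\{\delta_t^{\bar x},\ \bar x\in X^{t^c},\ t\in\mathbb{Z}^d\}$ of real-valued functions $\delta_t^{\bar x}(x,u)$, $x,u\in X^t$, such that for all $t\in\mathbb{Z}^d$, $\bar x\in X^{t^c}$, $$\delta_t^{\bar x}(x,u)=\delta_t^{\bar x}(x,y)+\delta_t^{\bar x}(y,u),\qquad x,u,y\in X^t,$$ and for all distinct $t,s\in\mathbb{Z}^d$ and $\bar x\in X^{\{t,s\}^c}$, $$\delta_t^{\bar xy}(x,u)+\delta_s^{\bar xu}(y,v)=\delta_s^{\bar xx}(y,v)+\delta_t^{\bar xv}(x,u),\qquad x,u\in X^t,\ y,v\in X^s.$$ It is quasilocal if for all $t\in\mathbb{Z}^d$ and $x,u\in X^t$, $$\lim_{\Lambda\uparrow t^c}\ \sup_{\bar x,\bar y\in X^{t^c}:\ \bar x_\Lambda=\bar y_\Lambda}\bigl|\delta_t^{\bar x}(x,u)-\delta_t^{\bar y}(x,u)\bigr|=0.$$ A random field is a probability measure $P$ on $(X^{\mathbb{Z}^d},\mathcal{B}^{\mathbb{Z}^d})$; $P_S$ is its marginal on $X^S$, with $P_{\emptyset}=1$ on the empty configuration; for $A\in\mathcal{B}^{S}$, $P(A)$ means $P_S(A)$. It is positive if $P_V(x)>0$ for all $V\in W$, $x\in X^V$. All random fields considered are positive. A filtration means a sequence $\mathcal{F}=\{\mathcal{B}^{\Lambda_n}\}_{n\ge1}$, where $\Lambda_n\in W$, $\Lambda_n\subset\Lambda_{n+1}$, $\bigcup_n\Lambda_n=\mathbb{Z}^d$.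 Finite-conditional distributions of $P$: $g_t^z(x)=P_{t\cup\Lambda}(xz)/P_\Lambda(z)$, $x\in X^t$, $z\in X^\Lambda$, for $t\in\mathbb{Z}^d$ and finite $\Lambda\subset t^c$. For $t\in\mathbb{Z}^d$, $\mathcal{X}_t(\mathcal{F})$ is the set of all $\bar x\in X^{t^c}$ for which the limits $g_t^{\bar x}(x)=\lim_{n\to\infty}g_t^{\bar x_{\Lambda_n\setminus t}}(x)$ exist for all $x\in X^t$. The one-point transition energies of $P$ with respect to $\mathcal{F}$ (defined when all the $g_t^{\bar x}(x)$ are positive, which is part of the assertion that they equal $\delta_t^{\bar x}$) are $\Delta_t^{\bar x}(x,u)=\ln\bigl(g_t^{\bar x}(x)/g_t^{\bar x}(u)\bigr)$, $x,u\in X^t$, $\bar x\in\mathcal{X}_t(\mathcal{F})$, $t\in\mathbb{Z}^d$. Definition. A positive random field $P$ is a Gibbs random field if there exist a filtration $\mathcal{F}=\{\mathcal{B}^{\Lambda_n}\}_{n\ge1}$ and sets $\mathcal{Y}_t(\mathcal{F})\subset\mathcal{X}_t(\mathcal{F})$ with $P(\mathcal{Y}_t(\mathcal{F}))=1$, $t\in\mathbb{Z}^d$, such that for all $t\in\mathbb{Z}^d$ and $\bar x\in\mathcal{Y}_t(\mathcal{F})$ the limits $\lim_{n\to\infty}g_t^{\bar x_{\Lambda_n\setminus t}}(x)=g_t^{\bar x}(x)$, $x\in X^t$, are positive and the convergence is uniform with respect to $\bar x\in\mathcal{Y}_t(\mathcal{F})$. *)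

(* Defs.v *)
From HB Require Import structures.
From mathcomp Require Import all_boot all_order all_algebra.
From mathcomp Require Import all_classical all_reals all_analysis.
Set Implicit Arguments.
Unset Strict Implicit.
Unset Printing Implicit Defensive.
Import Order.TTheory GRing.Theory Num.Theory.
Import numFieldNormedType.Exports.
Local Open Scope classical_set_scope.
Local Open Scope ring_scope.

Notation site d := 'rV[int]_d.

(* The set W(S). *)
Definition regions d (S : set (site d)) : set (set (site d)) :=
  [set V | [/\ V !=set0, finite_set V & V `<=` S]].

(* The limit of h along regions V increasing to S is a; h is extended-real valued because it
   is applied to a supremum that is not known in advance to be finite. *)
Definition region_lim (R : realType) d (S : set (site d))
    (h : set (site d) -> \bar R) (a : R) : Prop :=
  forall e : R, 0 < e ->
    exists2 V0, regions S V0 &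
      forall V, regions S V -> V0 `<=` V -> (`|h V - a%:E| < e%:E)%E.

(* X^S. The argument hX makes the type nonempty, as the library's measurable
   types are pointed. *)
Definition conf (X : finType) (hX : (1 < #|X|)%N) d (S : set (site d)) : Type :=
  S -> X.

Section Configurations.
Variables (X : finType) (hX : (1 < #|X|)%N) (d : nat).
Implicit Types S T U : set (site d).
Local Notation conf := (conf hX).

HB.instance Definition _ S := gen_eqMixin (conf S).
HB.instance Definition _ S := gen_choiceMixin (conf S).
HB.instance Definition _ S :=
  isPointed.Build (conf S) (fun=> enum_val (Ordinal (ltnW hX))).

Definition cylinders S : set (set (conf S)) :=
  [set C | exists (i : S) (B : set X), C = [set x | B (x i)]].

(* The product sigma-algebra of the discrete ones. *)
HB.instance Definition _ S :=
  @isMeasurable.Build (sigma_display (@cylinders S)) (conf S)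
    <<s @cylinders S >> (@sigma_algebra0 _ setT _)
    (@sigma_algebraC (conf S) _) (@sigma_algebra_bigcup _ setT _).

(* x_T *)
Definition restr S T (TS : T `<=` S) (x : conf S) : conf T :=
  fun i => x (SigSub (mem_set (TS _ (set_mem (valP i))))).

Lemma concat_subproof S T U (eU : S `|` T = U) (i : U) :
  ~ S (val i) -> T (val i).
Proof. by move=> nS; have := set_mem (valP i); rewrite -{1}eU => -[]. Qed.

(* xy, used only for disjoint S and T. The index set U of the result is a
   parameter, since it often equals S `|` T only propositionally. *)
Definition concat S T U (eU : S `|` T = U) (x : conf S) (y : conf T) : conf U :=
  fun i => match pselect (S (val i)) with
    | left Si => x (SigSub (mem_set Si))
    | right nSi => y (SigSub (mem_set (concat_subproof eU nSi)))
    end.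

End Configurations.

Lemma setC2Ur d (t s : site d) : t <> s ->
  ~` [set t; s] `|` [set s] = ~` [set t].
Proof.
move=> ts; apply/seteqP; split=> i /=; first by case=> [/not_orP[]//|-> /esym].
by move=> it; have [->|/eqP si] := eqVneq i s; [right|left; case].
Qed.

Lemma setC2Ul d (t s : site d) : t <> s ->
  ~` [set t; s] `|` [set t] = ~` [set s].
Proof. by move=> ts; rewrite setUC [X in ~` X]setUC setUC setC2Ur//; exact/nesym. Qed.

Section EnergyFields.
Variables (R : realType) (X : finType) (hX : (1 < #|X|)%N) (d : nat).
Local Notation conf := (conf hX).
Variable delta : forall t : site d,
  conf (~` [set t]) -> conf [set t] -> conf [set t] -> R.

Definition transition_energy_field : Prop :=
  (forall t (xb : conf (~` [set t])) (x u y : conf [set t]),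
     delta xb x u = delta xb x y + delta xb y u) /\
  (forall t s (ts : t <> s) (xb : conf (~` [set t; s]))
     (x u : conf [set t]) (y v : conf [set s]),
     delta (concat (setC2Ur ts) xb y) x u + delta (concat (setC2Ul ts) xb u) y v
     = delta (concat (setC2Ul ts) xb x) y v
       + delta (concat (setC2Ur ts) xb v) x u).

Definition oscillation t (x u : conf [set t]) (V : set (site d)) : \bar R :=
  ereal_sup [set r | exists xb yb : conf (~` [set t]),
    (forall i, V (val i) -> xb i = yb i) /\
    r = (`|delta xb x u - delta yb x u|)%:E].

Definition quasilocal : Prop :=
  forall t (x u : conf [set t]),
    region_lim (~` [set t]) (oscillation x u) 0.

End EnergyFields.

Section RandomFields.
Variables (R : realType) (X : finType) (hX : (1 < #|X|)%N) (d : nat).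
Local Notation conf := (conf hX).
Variable P : probability (conf [set: site d]) R.

(* P_S *)
Definition marginal (S : set (site d)) : set (conf S) -> \bar R :=
  pushforward P (restr (@subsetT _ S)).

Definition positive_field : Prop :=
  forall V, regions setT V -> forall x : conf V, (0 < marginal [set x])%E.

(* g_t^z(x), for finite V not containing t, possibly empty. *)
Definition cond_distr t (V : set (site d)) (z : conf V) (x : conf [set t]) : R :=
  fine (marginal [set concat (erefl ([set t] `|` V)) x z])
    / fine (marginal [set z]).

(* A filtration is given by its regions, indexed from 0. *)
Definition is_filtration (L : nat -> set (site d)) : Prop :=
  [/\ forall n, regions setT (L n),
      forall n, L n `<=` L n.+1
    & \bigcup_n L n = setT].

Section Filtration.
Variable L : nat -> set (site d).

Definition cond_distr_seq t (x : conf [set t]) (n : nat)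
    (xb : conf (~` [set t])) : R :=
  cond_distr (restr (@subDsetr _ (L n) [set t]) xb) x.

(* The set X_t(F). *)
Definition limit_points t : set (conf (~` [set t])) :=
  [set xb | forall x : conf [set t], cvgn (fun n => cond_distr_seq x n xb)].

Definition cond_distr_lim t (x : conf [set t]) (xb : conf (~` [set t])) : R :=
  limn (fun n => cond_distr_seq x n xb).

Definition transition_energy t (xb : conf (~` [set t])) (x u : conf [set t]) : R :=
  ln (cond_distr_lim x xb / cond_distr_lim u xb).

End Filtration.

(* Positivity of the limits is what makes the transition energies defined
   (ln is total in the library). *)
Definition corresponds_to
    (delta : forall t, conf (~` [set t]) -> conf [set t] -> conf [set t] -> R)
    : Prop :=
  forall L, is_filtration L ->
  forall t (xb : conf (~` [set t])), limit_points L xb ->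
    (forall x : conf [set t], 0 < cond_distr_lim L x xb) /\
    (forall x u : conf [set t], transition_energy L xb x u = delta t xb x u).

Definition gibbs_field : Prop :=
  positive_field /\
  exists (L : nat -> set (site d)) (Y : forall t, set (conf (~` [set t]))),
    is_filtration L /\
    forall t,
      [/\ Y t `<=` @limit_points L t,
          measurable (Y t),
          marginal (Y t) = 1%E,
          forall (x : conf [set t]) xb, Y t xb -> 0 < cond_distr_lim L x xb
        & forall x : conf [set t],
            {uniform Y t, cond_distr_seq L x @ \oo --> cond_distr_lim L x}].

End RandomFields.

(* Main.v *)
(* Telescoping the one-point energies along a list of sites, down to a fixed
   reference configuration, gives a finite-volume energy; the exchange identity
   makes its increment in any site t of the list equal to delta_t, whatever the
   order of the list. Hence the finite-volume Gibbs distributions Q satisfy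
     Q(A, x_t = x) <= exp(c) Q(A, x_t = u)
   for every event A not depending on x_t on which delta_t(x, u) <= c. This is a
   closed condition on finite-dimensional marginals, so it passes to the limit
   along an ultrafilter; the limit is finitely additive, hence, by compactness of
   the configuration space, sigma-additive on finite-dimensional events, and it
   extends to a probability P. By quasilocality, conditioning P on a large
   finite window pins delta_t down to a small error, so the ratio inequality
   squeezes g_t to 1 / sum_y exp(delta_t(y, x)), uniformly in all boundary
   conditions: every boundary condition is a limit point. *)
Require Import Defs.
From HB Require Import structures.
From mathcomp Require Import all_boot all_order all_algebra.
From mathcomp Require Import all_classical all_reals all_analysis.
From mathcomp Require Import perm lra.
Set Implicit Arguments.
Unset Strict Implicit.
Unset Printing Implicit Defensive.
Import Order.TTheory GRing.Theory Num.Theory.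
Import numFieldNormedType.Exports.
Local Open Scope classical_set_scope.
Local Open Scope ring_scope.

(** * Configurations on an arbitrary index set *)

Section Update.
Variables (T : choiceType) (X : finType).
Implicit Types (w : T -> X) (A : set (T -> X)).

Definition upd w t y : T -> X := fun s => if s == t then y else w s.

Lemma upd_id w t : upd w t (w t) = w.
Proof. by apply/funext => s; rewrite /upd; case: eqP => // ->. Qed.

Lemma upd_upd w t y z : upd (upd w t y) t z = upd w t z.
Proof. by apply/funext => s; rewrite /upd; case: eqP. Qed.

Lemma updC w s t y z : t != s -> upd (upd w t y) s z = upd (upd w s z) t y.
Proof.
move=> ts; apply/funext => r; rewrite /upd.
by case: (eqVneq r s) => // ->; rewrite eq_sym (negPf ts).
Qed.

(** One implication is enough: writing the old value back at [t] undoes the update. *)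
Definition insensitive t A := forall w y, A w -> A (upd w t y).

(** Sites outside [l] carry the boundary value [a], which also serves as the reference value of the
    finite-volume energy. *)
Definition ext (a : X) (l : seq T) (f : {ffun seq_sub l -> X}) : T -> X :=
  fun s => if insub s is Some i then f i else a.

Lemma extE a (l : seq T) w s :
  s \in l -> ext a [ffun i : seq_sub l => w (val i)] s = w s.
Proof. by move=> sl; rewrite /ext insubT ffunE. Qed.

Lemma ext_upd a (l : seq T) (f : {ffun seq_sub l -> X}) t y : t \in l ->
  ext a [ffun i => if val i == t then y (f i) else f i]
  = upd (ext a f) t (y (ext a f t)).
Proof.
move=> tl; apply/funext => s; rewrite /ext /upd.
case: insubP => [i _ <-|sl]; first rewrite ffunE; case: eqP => //.
  by move=> <-; rewrite valK.
by move=> st; rewrite st tl in sl.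
Qed.

End Update.

(** * Finite-volume Gibbs distributions *)

Section FiniteVolume.
Variables (R : realType) (T : choiceType) (X : finType) (a : X).
Variable D : T -> (T -> X) -> X -> X -> R.
Hypothesis D_upd : forall t w y, D t (upd w t y) = D t w.
Hypothesis D_add : forall t w x u y, D t w x u = D t w x y + D t w y u.
Hypothesis D_exchange : forall t s w x u y v, t != s ->
  D t (upd w s y) x u + D s (upd w t u) y v
  = D s (upd w t x) y v + D t (upd w s v) x u.
Implicit Types (w : T -> X) (A B : set (T -> X)).

(** The sites of [l] are reset to [a] one after another. A repeated site contributes [D t _ a a],
    which vanishes by additivity, so [l] may have repetitions. *)
Fixpoint energy (l : seq T) w : R :=
  if l is t :: l' then D t w (w t) a + energy l' (upd w t a) else 0.

(** Induction on [l]. If [t] is the head, the tail terms agree and additivity compares the head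
    terms. Otherwise the exchange identity with [v = a] says that the head terms change by the
    difference between [D t] at [w] and [D t] at [w] with the head site reset; the latter value is
    the induction hypothesis. *)
Lemma energyB l w t x u : t \in l ->
  energy l (upd w t x) - energy l (upd w t u) = D t w x u.
Proof.
elim: l w => [//|s l IHl] w; rewrite inE /=; have [->|ts /= tl] := eqVneq t s.
  move=> _; rewrite !D_upd !upd_upd /upd eqxx [D s w x a](D_add _ _ _ _ u).
  lra.
have st : s != t by rewrite eq_sym.
rewrite !(updC _ _ _ ts) /upd (negPf st) -!/(upd _ _ _).
have := D_exchange w x u (w s) a ts; rewrite upd_id.
have := IHl (upd w s a) tl; lra.
Qed.

Definition weight l (f : {ffun seq_sub l -> X}) : R := expR (energy l (ext a f)).

Definition gibbs l A : R :=
  (\sum_(f : {ffun seq_sub l -> X}) weight f * (ext a f \in A)%:R)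
  / \sum_(f : {ffun seq_sub l -> X}) weight f.

Lemma weight_gt0 l (f : {ffun seq_sub l -> X}) : 0 < weight f.
Proof. exact: expR_gt0. Qed.

Lemma partition_gt0 l : 0 < \sum_(f : {ffun seq_sub l -> X}) weight f.
Proof.
rewrite (bigD1 [ffun=> a])//= ltr_wpDr ?weight_gt0//.
by apply: sumr_ge0 => f _; rewrite ltW ?weight_gt0.
Qed.

Lemma gibbs_ge0 l A : 0 <= gibbs l A.
Proof.
apply: divr_ge0; last exact/ltW/partition_gt0.
by apply: sumr_ge0 => f _; rewrite mulr_ge0// ltW ?weight_gt0.
Qed.

Lemma gibbsT l : gibbs l setT = 1.
Proof.
rewrite /gibbs; under eq_bigr do rewrite in_setT mulr1.
by rewrite divff// gt_eqF ?partition_gt0.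
Qed.

Lemma gibbsU l A B : A `&` B = set0 -> gibbs l (A `|` B) = gibbs l A + gibbs l B.
Proof.
move=> AB; rewrite /gibbs -mulrDl -big_split /=; congr (_ / _).
apply: eq_bigr => f _; rewrite -mulrDr; congr (_ * _); rewrite in_setU -natrD.
case: (boolP (_ \in A)) => fA; case: (boolP (_ \in B)) => fB //=.
by have : set0 (ext a f) by rewrite -AB; split; exact/set_mem.
Qed.

Lemma gibbs_ratio (l : seq T) t A x u c : t \in l -> insensitive t A ->
  (forall w, A w -> D t w x u <= c) ->
  gibbs l (A `&` [set w | w t = x]) <= expR c * gibbs l (A `&` [set w | w t = u]).
Proof.
move=> tl At Ac; rewrite /gibbs mulrA ler_pM2r ?invr_gt0 ?partition_gt0//.
(* Exchanging the values x and u at t maps one event onto the other. *)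
pose sw (f : {ffun seq_sub l -> X}) :=
  [ffun i => if val i == t then tperm x u (f i) else f i].
have swK : involutive sw.
  by move=> f; apply/ffunP => i; rewrite !ffunE; case: (val i == t); rewrite ?tpermK.
rewrite (reindex_inj (inv_inj swK)) big_distrr /=; apply: ler_sum => f _.
rewrite /weight /sw ext_upd//; set w := ext a f.
have [|] := boolP (_ \in _); last by move=> _; rewrite mulr0 mulr_ge0 ?mulr_ge0 ?expR_ge0.
rewrite inE => -[]; rewrite /= /upd eqxx -/(upd _ _ _) => Aw.
rewrite -[RHS](tpermR x u) => /perm_inj wu.
have {}Aw : A w by rewrite -(upd_id w t) -(upd_upd _ _ (tperm x u (w t))); exact: At.
rewrite (_ : w \in _ = true); last by apply/mem_set; split => //=; rewrite wu.
rewrite !mulr1 wu tpermR -expRD ler_expR.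
(* Since [w] has spin [u] at [t], [energyB] compares the swapped weight with the weight of [w]
   itself. *)
have wE : upd w t u = w by rewrite -wu upd_id.
have := energyB w x u tl; rewrite wE; have := Ac _ Aw; lra.
Qed.

End FiniteVolume.

(** * Infinite-volume limit *)

Lemma free_ultrafilter_nat : exists2 U : set_system nat, UltraFilter U & \oo `<=` U.
Proof. by have [U [UU sU]] := ultraFilterLemma eventually_filter; exists U. Qed.

(** The image of an ultrafilter is an ultrafilter, and on a compact segment it converges. One
    ultrafilter thus serves for uncountably many events at once. *)
Lemma ultra_cvg_itv (R : realType) (U : set_system nat) (f : nat -> R) a b :
  UltraFilter U -> (forall n, a <= f n <= b) -> exists y : R, f n @[n --> U] --> y.
Proof.
move=> UU fab.
have FU : UltraFilter (f n @[n --> U]).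
  split; first exact: fmap_proper_filter.
  move=> G GF sG; apply/seteqP; split => // A GA.
  have [//|UA] := in_ultra_setVsetC (f @^-1` A) UU.
  have : G (A `&` ~` A) by apply: filterI => //; exact: sG.
  by rewrite setICr => /filter_ex[].
have := @segment_compact R a b; rewrite compact_ultra => /(_ _ FU)[|y [_ ?]].
  by apply: nearW => n; rewrite /= in_itv /= fab.
by exists y.
Qed.

(** Codes that decode to nothing are dropped. Repetitions are harmless, because [energyB] does not
    require distinct sites. *)
Definition enum_box (T : countType) n : seq T := pmap unpickle (iota 0 n).

Lemma mem_enum_box (T : countType) (t : T) n : (pickle t < n)%N -> t \in enum_box T n.
Proof. by move=> tn; rewrite mem_pmap -(pickleK t) map_f// mem_iota. Qed.

Section InfiniteVolume.
Variables (R : realType) (T : countType) (X : finType) (a : X).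
Variable D : T -> (T -> X) -> X -> X -> R.
Hypothesis D_upd : forall t w y, D t (upd w t y) = D t w.
Hypothesis D_add : forall t w x u y, D t w x u = D t w x y + D t w y u.
Hypothesis D_exchange : forall t s w x u y v, t != s ->
  D t (upd w s y) x u + D s (upd w t u) y v
  = D s (upd w t x) y v + D t (upd w s v) x u.

Lemma gibbs_limit : exists m : set (T -> X) -> R,
  [/\ forall A, 0 <= m A, m setT = 1,
      forall A B, A `&` B = set0 -> m (A `|` B) = m A + m B
    & forall t A x u c, insensitive t A -> (forall w, A w -> D t w x u <= c) ->
        m (A `&` [set w | w t = x]) <= expR c * m (A `&` [set w | w t = u])].
Proof.
have [U UU ooU] := free_ultrafilter_nat.
have g01 A n : 0 <= gibbs a D (enum_box T n) A <= 1.
  rewrite gibbs_ge0 /= -(gibbsT a D (enum_box T n)) -(setUv A) gibbsU ?setICr//.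
  by rewrite lerDl gibbs_ge0.
have /choice[m mP] A : exists y : R, gibbs a D (enum_box T n) A @[n --> U] --> y.
  exact: ultra_cvg_itv (g01 A).
exists m; split.
- by move=> A; apply: (cvgr_to_ge (mP A)); apply: nearW => n; exact: gibbs_ge0.
- have := mP setT; under eq_fun do rewrite gibbsT.
  by move=> /cvg_unique; apply => //; exact: cvg_cst.
- move=> A B AB; have := mP (A `|` B); under eq_fun do rewrite gibbsU//.
  by move=> /cvg_unique; apply => //; exact: cvgD (mP A) (mP B).
- move=> t A x u c At Ac.
  (* The finite-volume inequality needs [t] in the box, which holds for all large [n], hence along
     [U]. *)
  apply: (ler_cvg_to (mP _) (cvgM (cvg_cst _) (mP _))); apply: ooU.
  exists (pickle t).+1 => // n /= tn.
  by apply: gibbs_ratio => //; exact: mem_enum_box.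
Qed.

End InfiniteVolume.

(** * Extension from finite-dimensional events *)

Section FiniteCoordinates.
Variables (X : finType) (hX : (1 < #|X|)%N) (d : nat) (S : set (site d)).
Local Notation conf := (conf hX S).
Implicit Types A B : set conf.

Definition finitary A :=
  exists l : seq S, forall x y : conf, {in l, x =1 y} -> A x -> A y.

Lemma finitary0 : finitary set0.
Proof. by exists [::]. Qed.

Lemma finitaryU : setU_closed finitary.
Proof.
move=> A B [k kA] [l lB]; exists (k ++ l) => x y xy [Ax|Bx]; [left|right].
  by apply: kA Ax => i ik; apply: xy; rewrite mem_cat ik.
by apply: lB Bx => i il; apply: xy; rewrite mem_cat il orbT.
Qed.

Lemma finitaryC : setC_closed finitary.
Proof. by move=> A [k kA]; exists k => x y xy nAx /kA Ay; apply/nAx/Ay => i /xy. Qed.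

(** Compactness of the configuration space: finite-dimensional events are clopen. This is what turns
    finite additivity into sigma-additivity. *)
Lemma finitary_compact (F : (set conf)^nat) : (forall n, finitary (F n)) ->
  finitary (\bigcup_n F n) ->
  exists N, \bigcup_n F n = \bigcup_(n < N) F n.
Proof.
move=> fF fUF; apply: contrapT => /forallNP noN.
have /choice[x xP] N : exists x, (\bigcup_n F n) x /\ ~ (\bigcup_(n < N) F n) x.
  apply: contrapT => /forallNP nx; apply: (noN N); apply/seteqP; split => y Fy.
    by apply: contrapT => nFy; apply: (nx y).
  by case: Fy => n _ Fny; exists n.
have [U UU ooU] := free_ultrafilter_nat.
(* Points escaping every finite subunion have an ultralimit y, which lies in some F n. *)
have /choice[y yP] (i : S) : exists a, U [set n | x n i = a].
  apply: contrapT => /forallNP na.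
  have : \forall n \near U, forall a, x n i <> a.
    by apply: filter_forall => a; have [/na|] := in_ultra_setVsetC [set n | x n i = a] UU.
  by move=> /filter_ex[n /(_ (x n i))].
have yA A : finitary A -> A y -> U [set n | A (x n)].
  move=> [l lA] Ay.
  have : \forall n \near U, forall i : seq_sub l, x n (val i) = y (val i).
    by apply: filter_forall => i; exact: yP.
  by apply: filterS => n xy; apply: lA Ay => i il; rewrite (xy (SeqSub il)).
have [[n _ Fny]|ny] := pselect ((\bigcup_n F n) y).
  have /filter_ex[N [Fnx nN]] : U ([set N | F n (x N)] `&` [set N | (n < N)%N]).
    by apply: filterI; [exact: yA|apply: ooU; exists n.+1].
  by apply: (xP N).2; exists n.
have /filter_ex[N] := yA _ (finitaryC fUF) ny.
by apply; exact: (xP N).1.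
Qed.

End FiniteCoordinates.

(* conf already carries the product sigma-algebra, hence the alias. *)
Definition cylinder_algebra (X : finType) (hX : (1 < #|X|)%N) d (S : set (site d)) :=
  conf hX S.

HB.instance Definition _ X hX d S := Pointed.on (@cylinder_algebra X hX d S).

Section Extension.
Variables (X : finType) (hX : (1 < #|X|)%N) (d : nat) (S : set (site d)).
Local Notation T := (cylinder_algebra hX S).

HB.instance Definition _ :=
  @isAlgebraOfSets.Build (sigma_display (@finitary X hX d S)) T (@finitary X hX d S)
    (@finitary0 _ _ _ _) (@finitaryU _ _ _ _) (@finitaryC _ _ _ _).

Lemma sigma_finitary :
  <<s @finitary X hX d S >> = <<s @cylinders X hX d S >>.
Proof.
apply/seteqP; split; apply: smallest_sub; do ?exact: smallest_sigma_algebra.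
  move=> A [l lA].
  pose C (i : S) (a : X) : set (conf hX S) := [set x | x i = a].
  have mC i a : <<s @cylinders X hX d S >> (C i a).
    by apply: sub_sigma_algebra; exists i, [set a].
  (* Decompose [A] according to the finitely many patterns on [l] that occur in it. *)
  have -> : A = \bigcup_(f in [set f : {ffun seq_sub l -> X} |
      exists2 x, A x & forall i, x (val i) = f i]) \bigcap_i C (val i) (f i).
    apply/seteqP; split => [x Ax|y [f [x Ax xf] yf]].
      by exists [ffun i => x (val i)] => [|i _]; [exists x => // i|]; rewrite ?ffunE /C/= ?ffunE.
    by apply: lA Ax => i il; rewrite (xf (SeqSub il)) (yf (SeqSub il)).
  apply: (@fin_bigcup_measurable _ (conf hX S)); first exact: finite_finset.
  move=> f _; apply: (@fin_bigcap_measurable _ (conf hX S)); first exact: finite_finset.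
  by move=> i _; exact: mC.
move=> _ [i [B ->]]; apply: sub_sigma_algebra; exists [:: i] => x y xy /=.
by rewrite xy ?inE.
Qed.

Variables (R : realType) (m : set T -> R).
Hypothesis m_ge0 : forall A, 0 <= m A.
Hypothesis mT : m setT = 1.
Hypothesis mU : forall A B, A `&` B = set0 -> m (A `|` B) = m A + m B.

Let mu A : \bar R := (m A)%:E.

Let m0 : m set0 = 0.
Proof. by have := mU (setI0 set0); rewrite setU0; lra. Qed.

Let m_bigcup n (F : (set T)^nat) : trivIset setT F ->
  m (\bigcup_(i < n) F i) = \sum_(i < n) m (F i).
Proof.
move=> tF; elim: n => [|n IHn]; first by rewrite II0 bigcup_set0 big_ord0.
rewrite IIS bigcup_setU bigcup_set1 big_ord_recr /= -IHn mU//.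
rewrite setI_bigcupl; apply: bigcup0 => i /= ni.
by move/trivIsetP : tF; apply => //; rewrite ltn_eqF.
Qed.

(** By compactness finitely many of the disjoint sets already cover the union, so the others are
    empty and the partial sums are eventually constant. *)
Let mu_sigma_additive : semi_sigma_additive mu.
Proof.
move=> F fF tF fUF.
have [N UN] := finitary_compact fF fUF.
have F0 n : (N <= n)%N -> F n = set0.
  move=> Nn; apply/seteqP; split => // x Fnx.
  have [k /= kN Fkx] : (\bigcup_(n < N) F n) x by rewrite -UN; exists n.
  have : (F k `&` F n) x by [].
  by move/trivIsetP : tF => ->//; rewrite ltn_eqF// (leq_trans kN).
apply: cvg_near_cst; exists N => // n /= Nn.
rewrite /mu sumEFin UN (m_bigcup _ tF) -(big_mkord xpredT (m \o F)).
rewrite (big_cat_nat (leq0n N) Nn)//= [X in _ + X]big_nat [X in _ + X]big1 ?addr0// => i /andP[Ni _].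
by rewrite F0.
Qed.

HB.instance Definition _ := isMeasure.Build _ T R mu
  (congr1 EFin m0) (fun A => m_ge0 A) mu_sigma_additive.


Lemma kolmogorov_extension : exists P : probability (conf hX S) R,
  forall A, finitary A -> P A = (m A)%:E.
Proof.
pose nu (A : set (conf hX S)) : \bar R := measure_extension mu A.
have nu0 : nu set0 = 0%E by exact: measure0.
have nu_ge0 A : (0 <= nu A)%E by exact: measure_ge0.
have nu_add : semi_sigma_additive nu.
  (* The Caratheodory extension lives on the sigma-algebra generated by finitary events;
     [sigma_finitary] identifies it with the product one. *)
  have := @measure_semi_sigma_additive _ _ _ (measure_extension mu).
  by rewrite /semi_sigma_additive /measurable /= sigma_finitary.
have nuE A : finitary A -> nu A = (m A)%:E.
  by move=> fA; rewrite /nu /measure_extension measurable_mu_extE.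
pose nu' : {measure set (conf hX S) -> \bar R} :=
  HB.pack nu (isMeasure.Build _ _ _ nu nu0 nu_ge0 nu_add).
have nuT : nu' setT = 1%E by rewrite [LHS]nuE ?mT//; exists [::].
pose P : probability (conf hX S) R :=
  HB.pack nu (isMeasure.Build _ _ _ nu nu0 nu_ge0 nu_add)
    (Measure_isProbability.Build _ _ _ nu' nuT).
by exists P.
Qed.

End Extension.

(** * Consequences of the ratio inequality *)

Section GibbsianContent.
Variables (R : realType) (T : choiceType) (X : finType) (a : X).
Variable D : T -> (T -> X) -> X -> X -> R.
Hypothesis D_add : forall t w x u y, D t w x u = D t w x y + D t w y u.
Hypothesis D_quasilocal : forall t (e : R), 0 < e -> exists2 k : seq T, t \notin k &
  forall w w' x u, {in k, w =1 w'} -> `|D t w x u - D t w' x u| <= e.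
Variable m : set (T -> X) -> R.
Hypothesis m_ge0 : forall A, 0 <= m A.
Hypothesis mT : m setT = 1.
Hypothesis mU : forall A B, A `&` B = set0 -> m (A `|` B) = m A + m B.
Hypothesis m_ratio : forall t A x u c,
  insensitive t A -> (forall w, A w -> D t w x u <= c) ->
  m (A `&` [set w | w t = x]) <= expR c * m (A `&` [set w | w t = u]).
Implicit Types (w : T -> X) (A B : set (T -> X)).

Lemma transition_bounded t : exists M, forall w x u, D t w x u <= M.
Proof.
have [k _ kD] := D_quasilocal t ltr01.
(* Up to an error 1, [D t] depends only on the window [k]. The sum over the finitely many patterns
   and spin pairs is a crude substitute for a maximum. *)
pose M := \sum_(f : {ffun seq_sub k -> X}) \sum_(p : X * X) `|D t (ext a f) p.1 p.2|.
exists (1 + M) => w x u; pose f := [ffun i : seq_sub k => w (val i)].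
have wf : {in k, w =1 ext a f} by move=> s sk; rewrite extE.
have := kD _ _ x u wf; rewrite ler_norml => /andP[_].
have : `|D t (ext a f) x u| <= M.
  rewrite /M (bigD1 f)//= (bigD1 (x, u))//= -addrA lerDl.
  by apply: addr_ge0; apply: sumr_ge0 => // f' _; apply: sumr_ge0.
have := ler_norm (D t (ext a f) x u); lra.
Qed.

Lemma content_split t A : m A = \sum_x m (A `&` [set w | w t = x]).
Proof.
have m0 : m set0 = 0 by have := mU (setI0 set0); rewrite setU0; lra.
suff mE s : uniq s ->
    m (A `&` [set w | w t \in s]) = \sum_(x <- s) m (A `&` [set w | w t = x]).
  rewrite -big_enum -mE ?enum_uniq//; congr m; apply/seteqP.
  by split => w => [Aw|[]//]; split => //=; rewrite mem_enum.
elim: s => [_|x s IHs /= /andP[xs us]].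
  by rewrite big_nil -m0; congr m; apply/seteqP; split => // w [].
rewrite big_cons -(IHs us) -mU; last first.
  by apply/seteqP; split => // w [[_ /= ->] [_ /=]]; rewrite (negPf xs).
congr m; rewrite -setIUr; congr (_ `&` _); apply/seteqP; split => w /=.
  by rewrite inE => /orP[/eqP|]; [left|right].
by rewrite inE => -[/eqP ->|->]; rewrite ?orbT.
Qed.

(** Induction on [l]: if fixing one more spin gave content 0, the ratio inequality with a global
    bound on [D t] would make every other spin null too, and so the whole smaller cylinder. *)
Lemma content_cylinder_gt0 (l : seq T) w : 0 < m [set w' : T -> X | {in l, w' =1 w}].
Proof.
elim: l w => [|t l IHl] w.
  by rewrite (_ : [set _ | _] = setT) ?mT//; apply/seteqP; split.
have [tl|tl] := boolP (t \in l).
  rewrite (_ : [set _ | _] = [set w' : T -> X | {in l, w' =1 w}])//; apply/seteqP.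
  split => w' ww' s sl; apply: ww'; first by rewrite inE sl orbT.
  by move: sl; rewrite inE => /predU1P[->|].
rewrite (_ : [set _ | _] = [set w' : T -> X | {in l, w' =1 w}] `&` [set w' | w' t = w t]).
  set A := [set w' : T -> X | {in l, _}].
  have At : insensitive t A.
    move=> w' y Aw' s sl; rewrite /upd; case: eqP => [st|_]; last exact: Aw'.
    by rewrite -st sl in tl.
  have [M MD] := transition_bounded t; have := IHl w; rewrite (content_split t).
  rewrite [X in _ -> is_true X]lt_neqAle m_ge0 andbT eq_sym; apply: contraTneq => m0.
  rewrite -leNgt; apply: sumr_le0 => x _; rewrite -(mulr0 (expR M)) -m0.
  by apply: m_ratio => // w' _; exact: MD.
apply/seteqP; split => w' /=.
  by move=> ww'; split => [s sl|]; apply: ww'; rewrite inE ?sl ?eqxx ?orbT.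
by move=> [ww' wt] s; rewrite inE => /predU1P[->|/ww'].
Qed.

(** The one-point Gibbs distribution: exp(D(x,r)) divided by the sum over y of exp(D(y,r)) is the
    same for every reference spin r, and here r = x. *)
Definition conditional t w x : R := (\sum_y expR (D t w y x))^-1.

Lemma transition_refl t w x : D t w x x = 0.
Proof. by have := D_add t w x x x; lra. Qed.

Lemma conditional_gt0 t w x : 0 < conditional t w x.
Proof.
rewrite invr_gt0 (bigD1 x)//= ltr_wpDr ?expR_gt0// sumr_ge0// => y _.
Qed.

Lemma conditional_ratio t w x u :
  conditional t w x / conditional t w u = expR (D t w x u).
Proof.
rewrite /conditional invrK; under [X in _ * X]eq_bigr do rewrite (D_add _ _ _ _ x) expRD.
rewrite -mulr_suml mulrA mulVf ?mul1r// gt_eqF// -invr_gt0.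
exact: (conditional_gt0 t w x).
Qed.

(** With q = exp(e), the ratio inequality on [A] bounds the content of each spin by q exp(D(y,z))
    times that of any other. Summing over one spin, in both directions, traps the conditional
    content g between S^-1 / q and q S^-1. *)
Lemma conditional_estimate t A w e x : insensitive t A -> 0 < m A -> 0 <= e ->
  (forall w' y z, A w' -> `|D t w' y z - D t w y z| <= e) ->
  `|m (A `&` [set w' | w' t = x]) / m A - conditional t w x| <= expR e - 1.
Proof.
move=> At A0 e0 AD.
set b := fun y => m (A `&` [set w' | w' t = y]).
have bb y z : b y <= expR e * (expR (D t w y z) * b z).
  rewrite mulrA -expRD; apply: m_ratio => // w' Aw'.
  by have := AD _ y z Aw'; rewrite ler_norml => /andP[_]; lra.
set g := b x / m A; set q := expR e; set S := \sum_y expR (D t w y x).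
have q1 : 1 <= q by rewrite -expR0 ler_expR.
have S1 : 1 <= S.
  rewrite /S (bigD1 x)//= transition_refl expR0 lerDl sumr_ge0// => y _; exact: expR_ge0.
have g1 : g <= 1.
  rewrite ler_pdivrMr// mul1r (content_split t A) (bigD1 x)//= lerDl sumr_ge0//.
have S0 : 0 < S by exact: lt_le_trans S1.
have bE : b x = g * m A by rewrite divfK// gt_eqF.
clearbody g.
have qSg : 1 <= S * (q * g).
  rewrite -(ler_pM2r A0) mul1r -!mulrA -bE (content_split t A).
  by rewrite mulrCA mulr_suml mulr_sumr; apply: ler_sum => y _; exact: bb.
have Sgq : S * g <= q.
  rewrite -(ler_pM2r A0) -mulrA -bE [X in q * X](content_split t A).
  rewrite mulr_suml mulr_sumr; apply: ler_sum => y _.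
  have /(ler_wpM2l (expR_ge0 (D t w y x))) := bb x y.
  rewrite [X in _ <= X -> _]mulrCA [expR (D t w y x) * (expR _ * _)]mulrA.
  by rewrite -expRD -D_add transition_refl expR0 mul1r.
have Sg : S^-1 <= q * g by rewrite -[S^-1]mulr1 ler_pdivrMl.
have gS : g <= S^-1 * q by rewrite ler_pdivlMl.
have SV1 : S^-1 <= 1 by rewrite invf_le1.
have q0 : 0 <= q - 1 by lra.
(* As g and S^-1 are at most 1, these products turn the multiplicative bounds into the additive
   error q - 1. *)
have : 0 <= (q - 1) * (1 - S^-1) by rewrite mulr_ge0// subr_ge0.
have : 0 <= (q - 1) * (1 - g) by rewrite mulr_ge0// subr_ge0.
by rewrite ler_norml /conditional -/S => ? ?; apply/andP; split; lra.
Qed.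

End GibbsianContent.

(** * Restrictions of configurations on the whole lattice *)

Section Bridge.
Variables (R : realType) (X : finType) (hX : (1 < #|X|)%N) (d : nat).
Local Notation conf := (conf hX).
Implicit Types (S V : set (site d)) (w : site d -> X) (t s : site d).

(** Configurations on [S] are handled as restrictions of total functions on the lattice, so that
    concatenation with one spin becomes [upd] and no transport between index sets is needed. *)
Definition window S w : conf S := fun i => w (val i).
Arguments window : clear implicits.

Definition glob (z : conf [set: site d]) : site d -> X :=
  fun s => z (SigSub (mem_set (I : [set: site d] s))).

Lemma restr_glob S (z : conf setT) : restr (@subsetT _ S) z = window S (glob z).
Proof. by apply/funext => i; congr z; exact: val_inj. Qed.

Lemma window_upd S w t y : ~ S t -> window S (upd w t y) = window S w.
Proof.
move=> St; apply/funext => i; rewrite /window /upd; case: eqP => // it.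
by have := set_mem (valP i); rewrite -/(val i) it.
Qed.

Lemma window_eq S w w' : (forall s, S s -> w s = w' s) -> window S w = window S w'.
Proof. by move=> ww'; apply/funext => i; apply: ww'; exact: set_mem (valP i). Qed.

Lemma window_eqP S w w' s : window S w = window S w' -> S s -> w s = w' s.
Proof. by move=> /(congr1 (fun z => z (SigSub (mem_set _)))) /[swap] Ss; apply. Qed.

Lemma concat_window S U s w y (eU : S `|` [set s] = U) : ~ S s ->
  concat eU (window S w) (fun=> y) = window U (upd w s y) :> conf U.
Proof.
move=> Ss; apply/funext => i; rewrite /concat /window /upd.
case: pselect => [Si|nSi] /=; case: eqP => //.
  by move=> is_; case: Ss; rewrite -is_.
by have /= := concat_subproof eU nSi.
Qed.

(** The value [a] at [t] is arbitrary: it is invisible in the window off [t]. *)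
Definition fill (a : X) t (xb : conf (~` [set t])) : site d -> X :=
  fun s => match pselect (s = t) with
    | left _ => a
    | right st => xb (SigSub (mem_set (st : (~` [set t]) s)))
    end.

Lemma window_fill a t (xb : conf (~` [set t])) : window _ (fill a xb) = xb.
Proof.
apply/funext => i; rewrite /window /fill; case: pselect => [it|it].
  by case: (set_mem (valP i) it).
by congr xb; exact: val_inj.
Qed.

Definition spin t (x : conf [set t]) : X := x (SigSub (mem_set (erefl t))).

Lemma cst_spin t (x : conf [set t]) : (fun=> spin x) = x.
Proof.
apply/funext => i; congr x; apply: val_inj => /=.
by have := set_mem (valP i).
Qed.

Lemma finitary_window V (x : conf V) : finite_set V ->
  finitary [set z : conf setT | window V (glob z) = x].
Proof.
move=> /finite_seqP[k Vk].
pose emb s : set_type [set: site d] := SigSub (mem_set (I : [set: site d] s)).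
exists (map emb k) => z z' zz' <- /=; apply: window_eq => s Vs.
by apply/esym/zz'/map_f; rewrite Vk in Vs.
Qed.

End Bridge.

Arguments window {X} hX {d} S w _.

(** * Transition energies as functions of configurations on the whole lattice *)

Section TransitionEnergies.
Variables (R : realType) (X : finType) (hX : (1 < #|X|)%N) (d : nat).
Local Notation conf := (conf hX).
Variable delta : forall t : site d, conf (~` [set t]) -> conf [set t] -> conf [set t] -> R.
Implicit Types (w : site d -> X) (t s : site d).

Definition flip_energy t w (x u : X) : R :=
  @delta t (window hX _ w) (fun=> x) (fun=> u).

Lemma flip_energy_upd t w y : flip_energy t (upd w t y) = flip_energy t w.
Proof. by apply/funext => x; apply/funext => u; rewrite /flip_energy window_upd//; apply. Qed.

Hypothesis delta_tef : transition_energy_field delta.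

Lemma flip_energy_add t w x u y :
  flip_energy t w x u = flip_energy t w x y + flip_energy t w y u.
Proof. exact: delta_tef.1. Qed.

Lemma flip_energy_exchange t s w x u y v : t != s ->
  flip_energy t (upd w s y) x u + flip_energy s (upd w t u) y v
  = flip_energy s (upd w t x) y v + flip_energy t (upd w s v) x u.
Proof.
move=> /eqP ts; have := delta_tef.2 t s ts (window hX _ w) (fun=> x) (fun=> u) (fun=> y) (fun=> v).
have nt : ~ (~` [set t; s]) t by apply; left.
have ns : ~ (~` [set t; s]) s by apply; right.
by rewrite !concat_window.
Qed.

Hypothesis delta_ql : quasilocal delta.

Lemma flip_energy_quasilocal t (e : R) : 0 < e -> exists2 k : seq (site d), t \notin k &
  forall w w' x u, {in k, w =1 w'} ->
    `|flip_energy t w x u - flip_energy t w' x u| <= e.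
Proof.
move=> e0.
(* Quasilocality gives one window per pair of spins; as the alphabet is finite, the union of these
   windows serves all pairs. *)
have /choice[k kP] (p : X * X) : exists k : seq (site d), t \notin k /\
  forall w w', {in k, w =1 w'} ->
    `|flip_energy t w p.1 p.2 - flip_energy t w' p.1 p.2| <= e.
  have [V rV osc] := @delta_ql t (fun=> p.1) (fun=> p.2) e e0.
  have [_ /finite_seqP[k Vk] Vt] := rV.
  exists k; split; first by apply/negP => tk; case: (Vt t); rewrite ?Vk.
  move=> w w' ww'; have /ltW := osc V rV (@subset_refl _ _).
  rewrite sube0 => oscV; rewrite -lee_fin; apply: le_trans oscV.
  apply: le_trans (lee_abs _); apply: ereal_sup_ubound.
  exists (window hX _ w), (window hX _ w'); split => // i Vi.
  by apply: ww'; rewrite Vk in Vi.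
exists (flatten [seq k p | p <- enum {: X * X}]).
  apply/negP => /flatten_mapP[p _]; exact/negP/(kP p).1.
move=> w w' x u ww'; apply: (kP (x, u)).2 => s sk; apply: ww'.
by apply/flatten_mapP; exists (x, u); rewrite ?mem_enum.
Qed.

End TransitionEnergies.

(** * The random field *)

Lemma filtration_eventually d (L : nat -> set (site d)) (k : seq (site d)) :
  is_filtration L -> exists N, forall n, (N <= n)%N -> [set` k] `<=` L n.
Proof.
move=> [_ Lmono LT].
have Lle n n' : (n <= n')%N -> L n `<=` L n'.
  by move=> /subnK <-; elim: (n' - n)%N => // i IHi; exact: subset_trans (Lmono _).
elim: k => [|s k [N IHk]]; first by exists 0.
have [n _ Lns] : (\bigcup_n L n) s by rewrite LT.
exists (maxn n N) => n'; rewrite geq_max => /andP[nn' Nn'] r /=.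
by rewrite inE => /predU1P[->|rk]; [exact: Lle Lns|exact: IHk].
Qed.

Section GibbsField.
Variables (R : realType) (X : finType) (hX : (1 < #|X|)%N) (d : nat).
Local Notation conf := (conf hX).
Variable delta : forall t : site d, conf (~` [set t]) -> conf [set t] -> conf [set t] -> R.
Hypothesis delta_tef : transition_energy_field delta.
Hypothesis delta_ql : quasilocal delta.
Local Notation D := (flip_energy delta).
Implicit Types (w : site d -> X) (t s : site d).

Let a : X := enum_val (Ordinal (ltnW hX)).

(** The content [m] is kept beside [P]: the ratio inequality is available for [m] on arbitrary
    events, while the two are linked through finite marginals. *)
Lemma gibbs_field_exists : exists (P : probability (conf [set: site d]) R)
    (m : set (site d -> X) -> R),
  [/\ [/\ forall A, 0 <= m A, m setT = 1 &
          forall A B, A `&` B = set0 -> m (A `|` B) = m A + m B],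
      forall t A x u c, insensitive t A -> (forall w, A w -> D t w x u <= c) ->
        m (A `&` [set w | w t = x]) <= expR c * m (A `&` [set w | w t = u]) &
      forall V (x : conf V), finite_set V ->
        marginal P [set x] = (m [set w | window hX V w = x])%:E].
Proof.
have [m [m0 mT mU mr]] := gibbs_limit a (flip_energy_upd delta)
  (flip_energy_add delta_tef) (flip_energy_exchange delta_tef).
pose m' (A : set (conf setT)) := m (window hX setT @^-1` A).
have [|||P PE] := @kolmogorov_extension X hX d setT R m'.
- by move=> A; exact: m0.
- exact: mT.
- by move=> A B AB; rewrite /m' preimage_setU mU// -preimage_setI AB preimage_set0.
exists P, m; split => // V x fV.
rewrite /marginal /pushforward (_ : _ @^-1` _ = [set z | window hX V (glob z) = x]).
  by rewrite PE//; exact: finitary_window.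
by apply/seteqP; split => z; rewrite /= restr_glob.
Qed.

(** * Convergence of the finite-conditional distributions *)

Section Correspondence.
Variables (P : probability (conf [set: site d]) R) (m : set (site d -> X) -> R).
Hypothesis m_ge0 : forall A, 0 <= m A.
Hypothesis mT : m setT = 1.
Hypothesis mU : forall A B, A `&` B = set0 -> m (A `|` B) = m A + m B.
Hypothesis m_ratio : forall t A x u c,
  insensitive t A -> (forall w, A w -> D t w x u <= c) ->
  m (A `&` [set w | w t = x]) <= expR c * m (A `&` [set w | w t = u]).
Hypothesis P_m : forall V (x : conf V), finite_set V ->
  marginal P [set x] = (m [set w | window hX V w = x])%:E.

Lemma content_window_gt0 V w : finite_set V ->
  0 < m [set w' | window hX V w' = window hX V w].
Proof.
move=> /finite_seqP[k Vk].
have := content_cylinder_gt0 a (flip_energy_quasilocal delta_ql) m_ge0 mT mU m_ratio k w.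
congr (0 < m _); apply/seteqP; split => w' ww'.
  by apply: window_eq => s; rewrite Vk => /ww'.
by move=> s sk; apply: (window_eqP ww'); rewrite Vk.
Qed.

Lemma field_positive : positive_field P.
Proof.
move=> V [_ fV _] x; rewrite P_m// lte_fin.
have -> : x = window hX V (fun s => if pselect (V s) is left Vs
    then x (SigSub (mem_set Vs)) else a).
  apply/funext => i; rewrite /window; case: pselect => [Vi|].
    by congr x; exact: val_inj.
  by case; exact: set_mem (valP i).
exact: content_window_gt0.
Qed.

(** Brings the finite-conditional distribution to the quotient treated by [conditional_estimate]. *)
Lemma cond_distrE V t w (x : conf [set t]) : finite_set V -> ~ V t ->
  let A := [set w' | window hX V w' = window hX V w] in
  cond_distr P (window hX V w) x = m (A `&` [set w' | w' t = spin x]) / m A.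
Proof.
move=> fV Vt A; rewrite /cond_distr !P_m ?finite_setU//=; congr (m _ / _).
have -> : concat (erefl ([set t] `|` V)) x (window hX V w)
    = window hX _ (upd w t (spin x)).
  apply/funext => i; rewrite /concat /window /upd; case: pselect => /= [it|/eqP/negPf ->//].
  by rewrite (introT eqP it) /spin; congr x; exact: val_inj.
apply/seteqP; split => w' /=.
  move=> ww'; split; last first.
    by have := window_eqP ww' (or_introl (erefl t)); rewrite /upd eqxx.
  apply: window_eq => s Vs; rewrite (window_eqP ww' (or_intror Vs)) /upd.
  by case: eqP => // st; case: Vt; rewrite -st.
move=> [ww' wt]; apply: window_eq => s; rewrite /upd; case: eqP => [-> //|st].
by case=> // Vs; exact: window_eqP ww' Vs.
Qed.

Definition limit_distr t (x : conf [set t]) (xb : conf (~` [set t])) : R :=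
  conditional D t (fill a xb) (spin x).

(** [N] is chosen before the boundary condition, since the quasilocality window depends only on [t]
    and the error. This is the source of uniform convergence. *)
Lemma cond_distr_seq_estimate L t (e : R) : is_filtration L -> 0 < e ->
  exists N, forall n, (N <= n)%N -> forall x (xb : conf (~` [set t])),
    `|cond_distr_seq P L x n xb - limit_distr x xb| <= e.
Proof.
move=> FL e0.
(* Chosen so that the error exp(ln(1 + e)) - 1 of [conditional_estimate] is exactly e. *)
have e1 : 0 < ln (1 + e) by rewrite ln_gt0// ltrDl.
have [k tk kD] := flip_energy_quasilocal delta_ql t e1.
have [N NL] := filtration_eventually k FL.
exists N => n Nn x xb; rewrite /cond_distr_seq.
have -> : restr (@subDsetr _ (L n) [set t]) xb = window hX _ (fill a xb).
  by rewrite -[in LHS](window_fill a xb).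
have fLt : finite_set (L n `\ t) by apply: finite_setD; have [/(_ n)[]] := FL.
have nLt : ~ (L n `\ t) t by move=> [_]; apply.
rewrite cond_distrE//; set A := [set w' | window hX _ w' = _].
have -> : e = expR (ln (1 + e)) - 1 by rewrite lnK ?posrE; lra.
apply: (conditional_estimate (flip_energy_add delta_tef) m_ge0 mU m_ratio).
- by move=> w y; rewrite /A /= window_upd.
- exact: content_window_gt0.
- exact: ltW.
- move=> w y z wA; apply: kD => s sk; apply: (window_eqP wA); split; first exact: NL.
  by move=> st; rewrite -st sk in tk.
Qed.

Lemma cond_distr_seq_cvg L t x (xb : conf (~` [set t])) : is_filtration L ->
  cond_distr_seq P L x n xb @[n --> \oo] --> limit_distr x xb.
Proof.
move=> FL; apply/cvgrPdist_le => e e0.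
have [N Ne] := cond_distr_seq_estimate t FL e0.
by exists N => // n /= Nn; rewrite distrC; exact: Ne.
Qed.

Lemma cond_distr_limE L t : is_filtration L ->
  @cond_distr_lim R X hX d P L t = @limit_distr t.
Proof.
move=> FL; apply/funext => x; apply/funext => xb.
by apply: cvg_lim => //; exact: cond_distr_seq_cvg.
Qed.

(** The normalising sums combine by additivity, so the quotient of the limits is exp of the
    transition energy. *)
Lemma field_corresponds : corresponds_to P delta.
Proof.
move=> L FL t xb _; rewrite /transition_energy cond_distr_limE//.
split => [x|x u]; first exact: conditional_gt0.
rewrite conditional_ratio; last exact: flip_energy_add.
by rewrite expRK /flip_energy window_fill !cst_spin.
Qed.

Lemma field_gibbs (L : nat -> set (site d)) : is_filtration L -> gibbs_field P.
Proof.
move=> FL; split; first exact: field_positive.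
(* Convergence is uniform over all boundary conditions, so the full space can be taken for each set
   [Y t]. *)
exists L, (fun=> setT); split => // t; split => //.
- by move=> xb _ x; apply/cvg_ex; exists (limit_distr x xb); exact: cond_distr_seq_cvg.
- by rewrite /marginal /pushforward preimage_setT probability_setT.
- by move=> x xb _; rewrite cond_distr_limE//; exact: conditional_gt0.
- move=> x; rewrite cond_distr_limE// => B /uniform_nbhs[E [entE EB]].
  have [e /= e0 eE] := entE.
  (* Half of e, because balls are open whereas the estimate is not strict. *)
  have [N Ne] := cond_distr_seq_estimate t FL (divr_gt0 e0 (ltr0n R 2)).
  exists N => // n /= Nn; apply: EB => y _; apply: eE; rewrite /ball/= distrC.
  by apply: le_lt_trans (Ne n Nn x y) _; rewrite ltr_pdivrMr// ltr_pMr// ltr1n.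
Qed.

End Correspondence.

End GibbsField.

(** * Existence of a filtration and conclusion *)

Lemma filtration_exists d : exists L : nat -> set (site d), is_filtration L.
Proof.
(* The shift by the code of the origin keeps the first regions nonempty. *)
exists (fun n => [set s | (pickle s <= n + pickle (0%R : site d))%N]).
split => [n|n s /= sn|]; last 2 first.
- by rewrite addSn ltnW.
- by apply/seteqP; split => // s _; exists (pickle s) => //=; rewrite leq_addr.
split => //; first by exists 0%R; rewrite /= leq_addl.
apply: (sub_finite_set _ (finite_seq (enum_box (site d) (n + pickle (0%R : site d)).+1))).
by move=> s /= sn; exact: mem_enum_box.
Qed.

Theorem theorem5 (R : realType) (X : finType) (hX : (1 < #|X|)%N)
    (d : nat) (hd : (0 < d)%N)
    (delta : forall t : site d,
       conf hX (~` [set t]) -> conf hX [set t] -> conf hX [set t] -> R) :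
  transition_energy_field delta -> quasilocal delta ->
  exists P : probability (conf hX [set: site d]) R,
    [/\ positive_field P, corresponds_to P delta & gibbs_field P].
Proof.
move=> delta_tef delta_ql.
have [P [m [[m0 mT mU] mr Pm]]] := gibbs_field_exists delta_tef.
have [L FL] := filtration_exists d.
exists P; split.
- exact: (field_positive delta_ql m0 mT mU mr Pm).
- exact: (field_corresponds delta_tef delta_ql m0 mT mU mr Pm).
- exact: (field_gibbs delta_tef delta_ql m0 mT mU mr Pm FL).
Qed.
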